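(* Let $n \geq 3$ and $q \geq 3$ be integers. Then for every $2$-connected graph $G$ on $n$ vertices, $$\hom(G,K_q) \leq \hom(C_n,K_q),$$ with equality if and only if $G = C_n$, unless $q = 3$ and $n = 5$, in which case $G = K_{2,3}$ also achieves equality (so that in this case equality holds if and only if $G = C_5$ or $G = K_{2,3}$). Equalities of graphs are up to isomorphism. The same conclusion holds for every $G$ in the larger family of $2$-edge-connected graphs on $n$ vertices.
   Context: All graphs $G$ are finite, simple and loopless. $K_q$ is the (loopless) complete graph on $q$ vertices, $C_n$ is the cycle on $n$ vertices, and $K_{2,3}$ is the complete bipartite graph with classes of sizes $2$ and $3$. $\hom(G,K_q)$ is the number of maps $f: V(G) \to V(K_q)$ such that $f(x)$ and $f(y)$ are adjacent (i.e. distinct) whenever $x$ and $y$ are adjacent in $G$; that is, the number of proper $q$-colorings of $G$. *)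

(* Defs.v *)
From mathcomp Require Import all_boot.

Set Implicit Arguments.
Unset Strict Implicit.
Unset Printing Implicit Defensive.

Record sgraph := SGraph {
  vert :> finType;
  adj : rel vert;
  adj_sym : symmetric adj;
  adj_irr : irreflexive adj
}.
Arguments adj {s} x y.

Definition edges (G : sgraph) : {set {set G}} :=
  [set e | [exists x, [exists y, adj x y && (e == [set x; y])]]].

Definition giso (G H : sgraph) : Prop :=
  exists f : G -> H, bijective f /\ forall x y, adj (f x) (f y) = adj x y.

Definition hom (G H : sgraph) : nat :=
  #|[set f : {ffun G -> H} |
      [forall x, forall y, adj x y ==> adj (f x) (f y)]]|.

Section Deletion.
Variable G : sgraph.

Definition induced_adj (A : {set G}) : rel {x : G | x \in A} :=
  [rel u v | adj (val u) (val v)].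

Lemma induced_adj_sym A : symmetric (@induced_adj A).
Proof. by move=> u v; apply: adj_sym. Qed.

Lemma induced_adj_irr A : irreflexive (@induced_adj A).
Proof. by move=> u; apply: adj_irr. Qed.

Definition induced (A : {set G}) : sgraph :=
  SGraph (@induced_adj_sym A) (@induced_adj_irr A).

Definition del_vertices (X : {set G}) : sgraph := induced (~: X).

Definition del_edges_adj (F : {set {set G}}) : rel G :=
  [rel x y | adj x y && ([set x; y] \notin F)].

Lemma del_edges_adj_sym F : symmetric (del_edges_adj F).
Proof. by move=> x y; rewrite /del_edges_adj /= adj_sym setUC. Qed.

Lemma del_edges_adj_irr F : irreflexive (del_edges_adj F).
Proof. by move=> x; rewrite /del_edges_adj /= adj_irr. Qed.

Definition del_edges (F : {set {set G}}) : sgraph :=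
  SGraph (del_edges_adj_sym F) (del_edges_adj_irr F).

End Deletion.

Definition connected (G : sgraph) : Prop :=
  0 < #|G| /\ forall x y : G, connect adj x y.

Definition k_connected (k : nat) (G : sgraph) : Prop :=
  k < #|G| /\ forall X : {set G}, #|X| < k -> connected (del_vertices X).

Definition k_edge_connected (k : nat) (G : sgraph) : Prop :=
  1 < #|G| /\
  forall F : {set {set G}},
    F \subset edges G -> #|F| < k -> connected (del_edges F).

Definition complete_adj (q : nat) : rel 'I_q := [rel i j : 'I_q | i != j].

Lemma complete_adj_sym q : symmetric (@complete_adj q).
Proof. by move=> i j; rewrite /complete_adj /= eq_sym. Qed.

Lemma complete_adj_irr q : irreflexive (@complete_adj q).
Proof. by move=> i; rewrite /complete_adj /= eqxx. Qed.

Definition complete (q : nat) : sgraph :=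
  SGraph (@complete_adj_sym q) (@complete_adj_irr q).

(* The conjunct i != j only matters for n = 1, where it excludes the loop. *)
Definition cycle_adj (n : nat) : rel 'I_n :=
  [rel i j : 'I_n | (i != j) && ((i.+1 %% n == j) || (j.+1 %% n == i))].

Lemma cycle_adj_sym n : symmetric (@cycle_adj n).
Proof. by move=> i j; rewrite /cycle_adj /= eq_sym orbC. Qed.

Lemma cycle_adj_irr n : irreflexive (@cycle_adj n).
Proof. by move=> i; rewrite /cycle_adj /= eqxx. Qed.

Definition cycle_graph (n : nat) : sgraph :=
  SGraph (@cycle_adj_sym n) (@cycle_adj_irr n).

Definition bipartite_adj (a b : nat) : rel ('I_a + 'I_b) :=
  fun u v => match u, v with
             | inl _, inr _ | inr _, inl _ => true
             | _, _ => false
             end.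

Lemma bipartite_adj_sym a b : symmetric (@bipartite_adj a b).
Proof. by move=> [i|i] [j|j]. Qed.

Lemma bipartite_adj_irr a b : irreflexive (@bipartite_adj a b).
Proof. by move=> [i|i]. Qed.

Definition complete_bipartite (a b : nat) : sgraph :=
  SGraph (@bipartite_adj_sym a b) (@bipartite_adj_irr a b).

(* Main.v *)
Require Import Defs.
From mathcomp Require Import all_boot.
From mathcomp Require Import zify.

Set Implicit Arguments.
Unset Strict Implicit.
Unset Printing Implicit Defensive.

(** Write p = q - 1. Colouring a nonempty set of vertices first and the rest of
a connected graph vertex by vertex, each new vertex next to a coloured one, costs
a factor at most p per new vertex ([card_colourings_spanning]). A set of N
vertices with at most p^N - p colourings therefore forces at most
p^(n-N) (p^N - p) <= p^n - p colourings of the whole graph, and strictly fewer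
than p^n - p when N < n ([hom_extend_colourings]). Since the n-cycle has p^n + p
colourings for n even and p^n - p for n odd ([hom_cycle_graph]), it suffices to
find such a set in every 2-edge-connected graph G other than a cycle
([cycle_or_few_colourings]), and to see when all the inequalities are
equalities.

Let C be a shortest cycle of G, of length l. It has no chord, so G is a cycle if
C is spanning. Otherwise, if l is odd, C itself has at most p^l - p
colourings. If l is even, 2-edge-connectivity gives an ear: a path with m >= 1
vertices outside C whose two ends are attached to C, at two distinct vertices if
m = 1 ([exists_ear]). If m >= 2, the union of C and the ear has fewer than
p^(l+m) - p colourings ([few_ear_colourings]). If m = 1, the new vertex is a
common neighbour of two vertices of C, and minimality of l forces l = 4 and an
induced K_{2,3} ([shortest_cycle_common_neighbour]). The latter has
q (p^3 + p (p-1)^3) colourings, which is p^5 - p minus p^2 (p-2)(p+1)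
([two_three_count]); this is where the exception q = 3, n = 5 comes from.

Everything is counted by ears: the colourings of an ear with prescribed colours
at its ends are walks in K_q ([size_walks]), and a cycle is an ear attached at
both ends to a single vertex.

For 2-connected graphs it remains to see that they are 2-edge-connected
([k_connected_edge_connected]). *)

(** * Walks in complete graphs *)

Section Walks.
Variable p : nat.
Implicit Types a b c : 'I_p.+1.

(** A walk is represented by its interior vertices only: [walks k a b] has k of
them, hence k + 1 edges. *)
Fixpoint walks k a b : seq (seq 'I_p.+1) :=
  if k is k'.+1 then
    [seq c :: t | c <- [seq c <- enum 'I_p.+1 | a != c], t <- walks k' c b]
  else nseq (a != b) [::].

Lemma mem_walks k a b t :
  (t \in walks k a b) = (size t == k) && path (fun c d => c != d) a (rcons t b).
Proof.
elim: k a t => [|k IHk] a [|c t] //=.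
- by rewrite mem_nseq eqxx !andbT lt0b.
- by rewrite mem_nseq andbF.
- by apply/negbTE/negP => /allpairsPdep[c [t [_ _]]].
rewrite eqSS; apply/allpairsPdep/idP => [[d [u [ad du [-> ->]]]]|].
  by move: ad du; rewrite mem_filter IHk => /andP[-> _] /andP[-> ->].
case/and3P=> st ac ct; exists c, t; split=> //.
  by rewrite mem_filter ac mem_enum.
by rewrite IHk st ct.
Qed.

Lemma uniq_walks k a b : uniq (walks k a b).
Proof.
elim: k a => [|k IHk] a /=; first by case: (a != b).
apply: allpairs_uniq_dep => [|c _|[c t] [d u] _ _ [-> ->]] //.
by rewrite filter_uniq // enum_uniq.
Qed.

Lemma size_walksS k a b :
  size (walks k.+1 a b) = \sum_(c | a != c) size (walks k c b).
Proof.
by rewrite /= size_allpairs_dep sumnE big_map big_filter big_enum_cond.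
Qed.

(** With q = p + 1 and W the number of walks, this is the formula
q W = p^(k+1) - (-1)^k (p [a = b] - [a <> b]) that the eigenvalues p and -1 of
K_q yield; moving the negative term to the left, which one it is depending on
the parity of k, avoids subtraction in [nat]. *)
Lemma size_walks k a b :
  p.+1 * size (walks k a b) + (if odd k then a != b : nat else p * (a == b))
    = p ^ k.+1 + (if odd k then p * (a == b) else a != b).
Proof.
elim: k a => [|k IHk] a.
  by rewrite /= size_nseq expn1; case: eqVneq => _ /=; lia.
have card_neq : #|[pred c | a != c]| = p.
  rewrite -[RHS]/(p.+1.-1) -[in RHS](card_ord p.+1) -(cardC1 a).
  by apply: eq_card => c; rewrite !inE eq_sym.
have eq_sum : \sum_(c | a != c) (c == b : nat) = (a != b).
  rewrite big_mkcond (bigD1 b) //= eqxx big1 => [|c /negPf ->].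
    by case: (a != b).
  by case: ifP.
have neq_sum : \sum_(c | a != c) (c != b : nat) + (a != b) = p.
  rewrite -[RHS]card_neq -eq_sum -big_split -sum1_card.
  by apply: eq_bigr => c _ /=; case: (c == b).
have := eq_bigr (fun c => _) (fun c (_ : a != c) => IHk c) :
  \sum_(c | a != c) _ = \sum_(c | a != c) _.
rewrite !big_split -big_distrr -size_walksS (sum_nat_const [pred c | a != c]).
rewrite card_neq -expnS /= -/(walks k.+1 a b).
move: (size _) (p ^ _) neq_sum => w e; case: (odd k) => /=;
  rewrite -?big_distrr /= ?eq_sum; move: (\sum_(c | a != c) _) => s;
  case: (a == b) => /=; lia.
Qed.

End Walks.

(** * Colourings of vertex sets *)

Section Colourings.
Variables (G : sgraph) (p : nat).
Implicit Types (S : {set G}) (x y v : G) (vs : seq G).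
Implicit Types (f g : {ffun G -> 'I_p.+1}).

Definition proper_on S f := {in S &, forall x y, adj x y -> f x != f y}.

(** The colour [ord0] outside S makes these functions correspond to the proper
colourings of the subgraph induced on S. *)
Definition colourings S : {set {ffun G -> 'I_p.+1}} :=
  [set f : {ffun G -> 'I_p.+1} |
     [forall x in S, forall y in S, adj x y ==> (f x != f y)]
       && [forall x in ~: S, f x == ord0]].

Lemma colouringsP S f :
  reflect (proper_on S f /\ {in ~: S, forall x, f x = ord0})
          (f \in colourings S).
Proof.
rewrite inE; apply: (iffP andP) => -[fS f0]; split.
- move=> x y Sx Sy; apply/implyP.
  by move/forall_inP/(_ x Sx)/forall_inP: fS; apply.
- by move=> x Sx; apply/eqP; move/forall_inP: f0; apply.
- apply/forall_inP => x Sx; apply/forall_inP => y Sy; apply/implyP.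
  exact: fS.
- by apply/forall_inP => x Sx; apply/eqP/f0.
Qed.

Lemma hom_colourings : hom G (complete p.+1) = #|colourings setT|.
Proof.
apply: eq_card => f; rewrite inE; apply/idP/colouringsP => [fP|[fP _]].
  split=> [x y _ _|x]; last by rewrite !inE.
  by move/forallP/(_ x)/forallP/(_ y)/implyP: fP; apply.
by apply/forallP=> x; apply/forallP=> y; apply/implyP/fP; rewrite !inE.
Qed.

Definition restrict S f : {ffun G -> 'I_p.+1} :=
  [ffun x => if x \in S then f x else ord0].

Lemma restrict_colouring S (T : {set G}) f :
  S \subset T -> f \in colourings T -> restrict S f \in colourings S.
Proof.
move/subsetP=> ST /colouringsP[fP _]; apply/colouringsP; split.
  by move=> x y Sx Sy; rewrite !ffunE Sx Sy; apply: fP; apply: ST.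
by move=> x; rewrite inE ffunE => /negPf ->.
Qed.

(** A colouring of S :|: vs is determined by its restriction g to S and by the
list of colours along vs, so M bounds the number of extensions of each g as soon
as [L g] contains all the lists of colours that may occur. *)
Lemma card_colourings_extend S vs M
    (L : {ffun G -> 'I_p.+1} -> seq (seq 'I_p.+1)) :
    (forall g, size (L g) <= M) ->
    {in colourings (S :|: [set:: vs]),
       forall f : {ffun G -> 'I_p.+1}, map f vs \in L (restrict S f)} ->
  #|colourings (S :|: [set:: vs])| <= M * #|colourings S|.
Proof.
move=> sizeL inL; set T := S :|: _ in inL *.
have rT f : f \in colourings T -> restrict S f \in colourings S.
  by apply: restrict_colouring; apply: subsetUl.
rewrite -sum1_card (partition_big _ _ rT) mulnC -sum_nat_const.
apply: leq_sum => g _; apply: leq_trans (sizeL g); rewrite sum1_card cardE.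
rewrite -(size_map (fun f : {ffun _ -> _} => map f vs)).
apply: uniq_leq_size; last first.
  move=> t /mapP[f]; rewrite mem_enum => /andP[/inL fL /eqP rf] ->.
  by rewrite -rf.
rewrite map_inj_in_uniq ?enum_uniq // => f1 f2.
rewrite !mem_enum => /andP[/colouringsP[_ f1_0] /eqP rf1].
case/andP=> /colouringsP[_ f2_0] /eqP rf2 eq12; apply/ffunP=> x.
have [Tx | T'x] := boolP (x \in T); last first.
  by rewrite -in_setC in T'x; rewrite f1_0 ?f2_0.
case/setUP: Tx => [Sx|]; last first.
  by rewrite inE => vs_x; move/eq_in_map: eq12; apply.
by have /ffunP/(_ x) := etrans rf1 (esym rf2); rewrite !ffunE Sx.
Qed.

Lemma card_colourings0 : #|colourings set0| = 1.
Proof.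
rewrite -(cards1 ([ffun=> ord0] : {ffun G -> 'I_p.+1})); apply: eq_card => f.
rewrite !inE; apply/idP/eqP => [|->]; last first.
  by apply/andP; split; apply/forall_inP => x; rewrite ?inE ?ffunE.
case/andP=> _ /forall_inP f0; apply/ffunP=> x; rewrite ffunE.
by apply/eqP/f0; rewrite setC0 inE.
Qed.

Lemma card_colourings1 x : #|colourings [set x]| <= p.+1.
Proof.
have := @card_colourings_extend set0 [:: x] p.+1
  (fun=> [seq [:: c] | c <- enum 'I_p.+1]).
rewrite card_colourings0 muln1.
have -> : set0 :|: [set:: [:: x]] = [set x] by apply/setP=> y; rewrite !inE.
apply=> [_ | f _]; first by rewrite size_map size_enum_ord.
by apply: map_f; rewrite mem_enum.
Qed.

(** The colours along an ear form a walk in K_q between the colours of its ends.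
Keeping track of equal ends gives sharp bounds for closed ears, and so for
cycles. *)
Lemma card_colourings_ear S x y vs M :
    x \in S -> y \in S -> path adj x (rcons vs y) ->
    (forall a b : 'I_p.+1, (x = y -> a = b) ->
       size (walks (size vs) a b) <= M) ->
  #|colourings (S :|: [set:: vs])| <= M * #|colourings S|.
Proof.
move=> Sx Sy xy_path sizeM.
apply: (card_colourings_extend
  (L := fun g => walks (size vs) (g x) (g y))) => [g|f /colouringsP[fP _]].
  by apply: sizeM => ->.
rewrite !ffunE Sx Sy mem_walks size_map eqxx -map_rcons path_map /=.
apply: (sub_in_path (P := mem (S :|: [set:: vs]))) xy_path => [u v uT vT uv|].
  exact: (fP u v uT vT uv).
apply/allP=> v; rewrite in_cons mem_rcons in_cons => v_ear.
change (v \in S :|: [set:: vs]); rewrite !inE.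
by case/or3P: v_ear => [/eqP->|/eqP->|->]; rewrite ?Sx ?Sy ?orbT.
Qed.

Lemma card_colourings_neighbour S x y :
  x \in S -> adj x y -> #|colourings (y |: S)| <= p * #|colourings S|.
Proof.
move=> Sx xy; have -> : y |: S = S :|: [set:: [:: y]].
  by apply/setP=> z; rewrite !inE orbC.
apply: (card_colourings_extend
  (L := fun g => [seq [:: c] | c <- enum (predC1 (g x))])) => [g|f].
  by rewrite size_map -cardE cardC1 card_ord.
case/colouringsP=> fP _; apply: map_f; rewrite mem_enum inE ffunE Sx /=.
by rewrite eq_sym; apply: fP xy; rewrite !inE ?Sx ?eqxx ?orbT.
Qed.

End Colourings.

(** * Ears *)

Section Connectivity.
Variable G : sgraph.
Implicit Types (S : {set G}) (x y z : G) (vs : seq G).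

Lemma connected_boundary S s t :
    (forall x y, connect adj x y) -> s \in S -> t \notin S ->
  exists x y, [/\ x \in S, y \notin S & adj x y].
Proof.
move=> conn Ss S't.
case: (boolP [exists x in S, [exists y, (y \notin S) && adj x y]]).
  by case/exists_inP=> x Sx /existsP[y /andP[S'y xy]]; exists x, y.
move/exists_inP=> noE; case/negP: S't.
rewrite -(closed_connect _ (conn s t)) //.
apply: intro_closed; first exact: sym_connect_sym (@adj_sym G).
move=> x y xy Sx; apply/negPn/negP=> S'y; apply: noE.
by exists x => //; apply/existsP; exists y; rewrite S'y.
Qed.

Lemma path_to_set (e : rel G) S y p :
    path e y p -> y \notin S -> last y p \in S ->
  exists vs z, [/\ z \in S, all [predC S] (y :: vs) & path e y (rcons vs z)].
Proof.
elim: p y => [|v p IHp] y /=; first by move=> _ /negP.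
case/andP=> yv vp S'y lastS; have [Sv | S'v] := boolP (v \in S).
  by exists [::], v; rewrite /= S'y yv.
have [vs [z [Sz S'vs vz]]] := IHp v vp S'v lastS.
by exists (v :: vs), z; split; rewrite //= ?S'y ?yv.
Qed.

Lemma k_edge_connected_connect :
  k_edge_connected 2 G -> forall x y, connect adj x y.
Proof.
case=> _ /(_ set0 (sub0set _)); rewrite cards0 => /(_ isT)[_ conn] x y.
apply: connect_sub (conn x y) => u v uv; apply: connect1.
by case/andP: uv.
Qed.

(** Start with an edge from x in S to v outside S and delete it: there is still
a path from v back to S. If that path reaches S at once, it does so through
another edge than the deleted one, hence at a vertex distinct from x. *)
Lemma exists_ear S s t :
    k_edge_connected 2 G -> s \in S -> t \notin S ->
  exists x y vs, [/\ x \in S /\ y \in S, path adj x (rcons vs y), uniq vs,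
    all [predC S] vs & 0 < size vs /\ (size vs = 1 -> x != y)].
Proof.
move=> G2 Ss S't; have conn := k_edge_connected_connect G2.
have [x [v [Sx S'v xv]]] := connected_boundary conn Ss S't.
case: G2 => _ /(_ [set [set x; v]]) []; rewrite ?cards1 //.
  rewrite sub1set inE; apply/existsP; exists x; apply/existsP; exists v.
  by rewrite xv /=.
move=> _ /(_ v x)/connectP[p vp def_x]; rewrite def_x in Sx.
have [vs [z [Sz S'vs]]] := path_to_set vp S'v Sx; rewrite -{}def_x in Sx.
rewrite rcons_path => /andP[/shortenP[vs' vvs' uniq_vs' sub_vs'] lastz].
have /andP[_ S'] := S'vs.
have sub_adj : subrel (del_edges_adj [set [set x; v]]) (@adj G).
  by move=> u w /andP[].
exists x, z, (v :: vs'); split=> //=.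
- by rewrite xv rcons_path (sub_path sub_adj vvs') (sub_adj _ _ lastz).
- by rewrite S'v; apply/allP=> u /sub_vs'/(allP S').
split=> // -[/size0nil def_vs']; apply/eqP=> def_z.
by move: lastz; rewrite def_vs' -def_z => /andP[_]; rewrite setUC inE eqxx.
Qed.

End Connectivity.

(** While S is not everything, some vertex outside S has a neighbour in S, and
its colour must avoid that of the neighbour. *)
Lemma card_colourings_spanning (G : sgraph) p (S : {set G}) s :
    (forall x y : G, connect adj x y) -> s \in S ->
  hom G (complete p.+1) <= p ^ (#|G| - #|S|) * #|colourings p S|.
Proof.
move=> conn; rewrite hom_colourings.
move def_m: (#|G| - #|S|) => m Ss.
elim: m S def_m Ss => [|m IHm] S def_m Ss.
  have -> : S = setT.
    by apply/eqP; rewrite eqEcard subsetT cardsT -subn_eq0 def_m eqxx.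
  by rewrite expn0 mul1n.
have /subsetPn[t _ S't] : ~~ ([set: G] \subset S).
  by apply: contra_eqN def_m; rewrite subTset => /eqP->; rewrite cardsT subnn.
have [x [y [Sx S'y xy]]] := connected_boundary conn Ss S't.
have := IHm (y |: S); rewrite cardsU1 S'y inE Ss orbT => /(_ _ isT) IH.
apply: leq_trans (IH _) _; first by lia.
by rewrite expnSr -mulnA leq_mul2l (card_colourings_neighbour p Sx xy) orbT.
Qed.

(** * From vertex to edge connectivity *)

Lemma connect_homo (T T' : finType) (e : rel T) (e' : rel T') (f : T -> T') :
  {homo f : x y / e x y >-> e' x y} ->
  {homo f : x y / connect e x y >-> connect e' x y}.
Proof.
move=> f_homo x y /connectP[s xs ->]; apply/connectP; exists (map f s).
  by rewrite path_map; apply: sub_path xs => u v; apply: f_homo.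
by rewrite last_map.
Qed.

(** Deleting either end of an edge uv also deletes uv. A third vertex w can thus
be reached from any vertex other than u in G - u, and from u in G - v. *)
Lemma k_connected_edge_connected G : k_connected 2 G -> k_edge_connected 2 G.
Proof.
case=> n_gt2 conn; split=> [|F sFE F_lt2]; first exact: ltnW.
split=> [|x y]; first exact: leq_trans n_gt2.
(* If F is empty, any two distinct vertices serve as u and v. *)
have [u [v [uv sF]]] : exists u v, u != v /\ F \subset [set [set u; v]].
  have [->|[e Fe]] := set_0Vmem F.
    have /card_gt1P[u [v [_ _ uv]]] : 1 < #|G| by apply: ltnW.
    by exists u, v; rewrite uv sub0set.
  have := subsetP sFE e Fe; rewrite inE.
  case/existsP=> u /existsP[v /andP[uv /eqP def_e]].
  exists u, v; split; first by apply: contraTneq uv => ->; rewrite adj_irr.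
  suff /eqP<- : [set e] == F by rewrite def_e.
  by rewrite eqEcard sub1set Fe cards1.
have avoid z s t : z \in [set u; v] -> s != z -> t != z ->
    connect (@adj (del_edges F)) s t.
  move=> uvz sz tz; have [|_ conn_z] := conn [set z]; first by rewrite cards1.
  have in_del r : r != z -> r \in ~: [set z] by rewrite !inE.
  have := conn_z (exist _ s (in_del s sz)) (exist _ t (in_del t tz)).
  apply: (connect_homo (f := val)) => -[a /= az] [b /= bz] ab.
  apply/andP; split; first exact: ab.
  apply/negP=> /(subsetP sF).
  rewrite inE => /eqP/setP/(_ z); rewrite uvz !inE.
  by move: (az) (bz); rewrite !inE ![_ == z]eq_sym => /negPf-> /negPf->.
have [w wu wv] : exists2 w : G, w != u & w != v.
  have /subsetPn[w _] : ~~ ([set: G] \subset [set u; v]).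
    apply: contraL n_gt2 => /subset_leq_card.
    by rewrite cardsT cards2 uv -ltnNge.
  by rewrite !inE negb_or => /andP[]; exists w.
have [u_in v_in] : u \in [set u; v] /\ v \in [set u; v].
  by rewrite !inE !eqxx orbT.
have via_w s :
    connect (@adj (del_edges F)) s w && connect (@adj (del_edges F)) w s.
  have [->|su] := eqVneq s u; last by rewrite !(avoid u).
  by rewrite !(avoid v).
have [/andP[xw _] /andP[_ wy]] := (via_w x, via_w y).
exact: connect_trans xw wy.
Qed.

(** * Colourings and isomorphisms, colourings of cycles *)

Lemma giso_sym (G H : sgraph) : giso G H -> giso H G.
Proof.
case=> f [[g fK gK] f_adj]; exists g; split; first by exists f.
by move=> x y; rewrite -f_adj !gK.
Qed.

Lemma giso_hom_leq (G H K : sgraph) : giso G H -> hom H K <= hom G K.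
Proof.
case=> f [[g fK gK] f_adj].
pose pull (h : {ffun H -> K}) := [ffun x => h (f x)].
have pull_inj : injective pull.
  move=> h1 h2 /ffunP eq_h; apply/ffunP=> y.
  by have := eq_h (g y); rewrite !ffunE gK.
rewrite /hom -(card_imset _ pull_inj).
apply/subset_leq_card/subsetP=> _ /imsetP[h + ->].
rewrite !inE => /forallP hP; apply/forallP=> x; apply/forallP=> y.
by rewrite !ffunE -f_adj; have /forallP := hP (f x); apply.
Qed.

Lemma giso_hom (G H K : sgraph) : giso G H -> hom G K = hom H K.
Proof.
move=> GH; apply/eqP; rewrite eqn_leq !giso_hom_leq //; exact: giso_sym.
Qed.

Lemma cycle_nthP (T : Type) (e : rel T) x0 s :
  reflect (forall i, i < size s -> e (nth x0 s i) (nth x0 s (i.+1 %% size s)))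
          (cycle e s).
Proof.
case: s => [|x s]; first by apply: ReflectT.
have nth_next i : i < (size s).+1 ->
  nth x0 (rcons s x) i = nth x0 (x :: s) (i.+1 %% (size s).+1).
  rewrite ltnS leq_eqVlt nth_rcons => /predU1P[->|lt_i].
    by rewrite modnn ltnn eqxx.
  by rewrite lt_i modn_small.
rewrite /cycle; apply: (iffP (pathP x0)); rewrite size_rcons => eP i lt_i.
  have := eP i lt_i; rewrite nth_next //.
  by rewrite -rcons_cons nth_rcons /= lt_i.
by rewrite -rcons_cons nth_rcons /= lt_i nth_next //; apply: eP.
Qed.

Lemma index_next (T : eqType) (c : seq T) x :
  uniq c -> x \in c -> index (next c x) c = (index x c).+1 %% size c.
Proof.
move=> Uc c_x; rewrite next_nth c_x; case: c Uc c_x => // y p Uc c_x.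
have := c_x; rewrite -index_mem ltnS leq_eqVlt => /predU1P[->|lt_i].
  by rewrite nth_default // modnn /= eqxx.
by rewrite -[nth y p _]/(nth y (y :: p) _.+1) index_uniq // modn_small.
Qed.

(** Listing the colours around the cycle turns its colourings into closed walks
with n edges in K_q. *)
Lemma hom_cycle_graph n p : 2 < n ->
  hom (cycle_graph n) (complete p.+1) + (if odd n then p else 0)
    = p ^ n + (if odd n then 0 else p).
Proof.
case: n => // m m_gt1.
pose colour (s : seq 'I_p.+1) := [ffun i : 'I_m.+1 => nth ord0 s i].
pose closed_walks := [seq a :: t | a <- enum 'I_p.+1, t <- walks m a a].
have mem_closed s :
    (s \in closed_walks) = (size s == m.+1) && cycle (fun c d => c != d) s.
  case: s => [|a t]; first by apply/negbTE/negP => /allpairsPdep[a [t [_ _]]].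
  apply/allpairsPdep/idP => [[b [u [_ + [-> ->]]]]|].
    by rewrite mem_walks.
  by move=> at_walk; exists a, t; rewrite mem_enum mem_walks.
have colour_inj : {in closed_walks &, injective colour}.
  move=> s t; rewrite !mem_closed => /andP[/eqP size_s _] /andP[/eqP size_t _].
  move/ffunP=> eq_st; apply: (eq_from_nth (x0 := ord0)) => [|i].
    by rewrite size_t.
  by rewrite size_s => lt_i; have := eq_st (Ordinal lt_i); rewrite !ffunE.
have uniq_closed : uniq closed_walks.
  apply: allpairs_uniq_dep => [|a _|[a t] [b u] _ _ [-> ->]] //.
    exact: enum_uniq.
  exact: uniq_walks.
have -> : hom (cycle_graph m.+1) (complete p.+1) = size closed_walks.
  rewrite -(size_map colour); apply: etrans (card_uniqP _); last first.
    by rewrite map_inj_in_uniq.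
  apply: eq_card => f; rewrite inE; apply/forallP/mapP => [fP | [s]].
    exists (map f (enum 'I_m.+1)); last first.
      apply/ffunP=> i.
      by rewrite ffunE (nth_map i) ?size_enum_ord // nth_ord_enum.
    rewrite mem_closed size_map size_enum_ord eqxx.
    apply/(cycle_nthP _ ord0) => i.
    rewrite size_map size_enum_ord => lt_i.
    have lt_i1 : i.+1 %% m.+1 < m.+1 by rewrite ltn_mod.
    have nth_f j (lt_j : j < m.+1) :
        nth ord0 (map f (enum 'I_m.+1)) j = f (Ordinal lt_j).
      rewrite (nth_map (Ordinal lt_j)) ?size_enum_ord //; congr (f _).
      exact: (nth_ord_enum _ (Ordinal lt_j)).
    rewrite (nth_f _ lt_i) (nth_f _ lt_i1).
    have /forallP/(_ (Ordinal lt_i1))/implyP := fP (Ordinal lt_i); apply.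
    apply/andP; split; last by rewrite eqxx.
    rewrite -val_eqE /=; move: lt_i; rewrite leq_eqVlt eqSS.
    case/predU1P=> [->|lt_i]; first by rewrite modnn; lia.
    by rewrite modn_small //; lia.
  rewrite mem_closed => /andP[/eqP size_s /(cycle_nthP _ ord0) + ] ->.
  rewrite size_s => sP i; apply/forallP=> j; apply/implyP=> /= /andP[_].
  rewrite !ffunE; case/orP=> /eqP<-; first exact: sP.
  by rewrite /complete_adj /= eq_sym; apply: sP.
pose W := size (walks m ord0 (ord0 : 'I_p.+1)).
have -> : size closed_walks = p.+1 * W.
  rewrite size_allpairs_dep sumnE big_map big_enum /=.
  rewrite (eq_bigr (fun=> W)) => [|a _].
    by rewrite sum_nat_const card_ord.
  apply/eqP; rewrite -(eqn_pmul2l (ltn0Sn p)).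
  rewrite -(eqn_add2r (if odd m then 0 else p)).
  by have := size_walks m a a; have := size_walks m ord0 (ord0 : 'I_p.+1);
     rewrite !eqxx !muln1 => -> ->.
have := size_walks m ord0 (ord0 : 'I_p.+1); rewrite eqxx muln1 /=.
by case: (odd m).
Qed.

(** * Shortest cycles *)

Section ShortestCycle.
Variable G : sgraph.
Implicit Types (x y z : G) (c d : seq G).

Definition simple_cycle c := [&& 2 < size c, uniq c & cycle adj c].

Definition shortest_cycle c :=
  simple_cycle c /\ forall d, simple_cycle d -> size c <= size d.

(** An ear attached to a single vertex closes up to a cycle. *)
Lemma exists_shortest_cycle :
  k_edge_connected 2 G -> exists c, shortest_cycle c.
Proof.
move=> G2; have /card_gt1P[x [t [_ _ xt]]] := G2.1.
have [|a [b [vs [[]]]]] := @exists_ear G [set x] x t G2 (set11 x).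
  by rewrite inE eq_sym.
rewrite !inE => /eqP-> /eqP-> ear Uvs /allP S'vs [vs_gt0 vs_neq1].
have c_cycle : simple_cycle (x :: vs).
  apply/and3P; split=> //=; last first.
    by rewrite Uvs andbT; apply/negP => /S'vs; rewrite /= !inE eqxx.
  case: (size vs) vs_gt0 vs_neq1 => [|[|k]] // _ /(_ erefl).
  by rewrite eqxx.
have ex_size : exists n, [exists c : n.-tuple G, simple_cycle c].
  by exists (size (x :: vs)); apply/existsP; exists (in_tuple (x :: vs)).
case: (ex_minnP ex_size) => n /existsP[c c_simple] n_min.
exists c; split=> // d d_simple.
by rewrite size_tuple n_min //; apply/existsP; exists (in_tuple d).
Qed.

Lemma shortest_cycle_rot k c : shortest_cycle c -> shortest_cycle (rot k c).
Proof.
case=> c_simple c_min; split;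
  by rewrite /simple_cycle ?size_rot ?rot_uniq ?rot_cycle.
Qed.

(** A chord would split the cycle into two shorter ones. *)
Lemma shortest_cycle_chordless c x y :
  shortest_cycle c -> x \in c -> y \in c -> adj x y ->
  y = next c x \/ x = next c y.
Proof.
move=> c_short c_x c_y xy; have [/and3P[_ Uc _] _] := c_short.
have [k s def_c] := rot_to c_x; rewrite -!(next_rot k Uc).
have := shortest_cycle_rot k c_short.
move: c_y; rewrite -(mem_rot k) {}def_c inE => /predU1P[yx|].
  by rewrite yx adj_irr in xy.
case/splitPr=> [[|v s1] [|w s2]] c'_short; first by left; rewrite /= eqxx.
- by left; rewrite /= eqxx.
- right.
  have [/and3P[_ Uc' _] _] := c'_short.
  by rewrite -(next_rotr 1 Uc') cats1 -rcons_cons rotr1_rcons /= eqxx.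
case: c'_short => /and3P[_ Uc' c'_cycle] c'_min.
suff /c'_min : simple_cycle [:: x, v & rcons s1 y].
  by rewrite /= size_rcons size_cat /=; lia.
apply/and3P; split; first by rewrite /= size_rcons.
  by move: Uc'; rewrite -cat_rcons -cat_cons cat_uniq => /and3P[].
have : path adj x ((v :: rcons s1 y) ++ rcons (w :: s2) x).
  by move: c'_cycle; rewrite -cat_rcons /= rcons_cat.
rewrite cat_path => /andP[xy_path _].
by rewrite /cycle rcons_path xy_path last_cons last_rcons adj_sym.
Qed.

Lemma shortest_cycle_triangle_free c x y z :
  shortest_cycle c -> 3 < size c -> adj x y -> adj y z -> ~~ adj z x.
Proof.
case=> _ c_min c_gt3 xy yz; apply/negP=> zx.
have adj_neq u v : adj u v -> u != v.
  by move=> uv; apply: contraTneq uv => ->; rewrite adj_irr.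
have /c_min : simple_cycle [:: x; y; z].
  have xz : adj x z by rewrite adj_sym.
  by rewrite /simple_cycle /= !inE negb_or xy yz zx !adj_neq.
by rewrite leqNgt c_gt3.
Qed.

Lemma giso_cycle_graph c :
  shortest_cycle c -> size c = #|G| -> giso G (cycle_graph #|G|).
Proof.
move=> c_short size_c; have [/and3P[_ Uc c_cycle] _] := c_short.
have c_all x : x \in c.
  have /eqP def_T : [set:: c] == setT.
    by rewrite eqEcard subsetT cardsT -size_c cardsE (card_uniqP Uc) /=.
  by have := in_setT x; rewrite -def_T inE.
have lt_idx x : index x c < #|G| by rewrite -size_c index_mem.
have nextE x y : ((index x c).+1 %% #|G| == index y c) = (y == next c x).
  rewrite -size_c -index_next //; apply/eqP/eqP => [|->] //.
  by move/esym/(congr1 (nth x c)); rewrite !nth_index ?mem_next.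
exists (fun x => Ordinal (lt_idx x)); split.
  apply: inj_card_bij; last by rewrite card_ord.
  by move=> x y [] /(congr1 (nth x c)); rewrite !nth_index.
move=> x y; rewrite /= /cycle_adj /= -val_eqE /= !nextE.
apply/andP/idP => [[_ /orP[]/eqP->]|xy].
- exact: next_cycle.
- by rewrite adj_sym; apply: next_cycle.
split; last first.
  apply/orP; have := shortest_cycle_chordless c_short (c_all x) (c_all y) xy.
  by case=> <-; [left | right].
apply: contraTneq xy => /(congr1 (nth x c)); rewrite !nth_index // => ->.
by rewrite adj_irr.
Qed.

Definition K23_index (u : complete_bipartite 2 3) : nat :=
  match u with inl i => i | inr j => 2 + j end.

Lemma K23_index_lt u : K23_index u < 5.
Proof. by case: u => i; rewrite /K23_index; case: i => i /=; lia. Qed.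

Lemma K23_index_inj : injective K23_index.
Proof.
case=> [i|i] [j|j]; rewrite /K23_index.
- by move/ord_inj->.
- by case: i => i /=; lia.
- by case: j => j /=; lia.
- by move/addnI/ord_inj->.
Qed.

(** The absence of triangles excludes edges within either of the two classes. *)
Lemma giso_complete_bipartite x y a b w :
    uniq [:: x; y; a; b; w] -> #|G| = 5 ->
    (forall u v z, adj u v -> adj v z -> ~~ adj z u) ->
    all (adj x) [:: a; b; w] -> all (adj y) [:: a; b; w] ->
  giso G (complete_bipartite 2 3).
Proof.
move=> Us card_G no_tri xs ys; apply: giso_sym.
pose s := [:: x; y; a; b; w].
exists (fun u => nth x s (K23_index u)); split.
  apply: inj_card_bij; last by rewrite card_G card_sum !card_ord.
  move=> u v /eqP; rewrite nth_uniq ?K23_index_lt // => /eqP.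
  exact: K23_index_inj.
have xy : ~~ adj x y.
  move: xs ys => /= /andP[xa _] /andP[ya _].
  by rewrite adj_sym; apply: (no_tri x a y) => //; rewrite adj_sym.
have rr u v : adj x u -> adj x v -> ~~ adj u v.
  move=> xu xv; rewrite adj_sym; apply: (no_tri u x v) => //.
  by rewrite adj_sym.
move: xs ys => /= /and4P[xa xb xw _] /and4P[ya yb yw _].
have adjE := (@adj_irr G, xa, xb, xw, ya, yb, yw, negPf xy,
  negPf (rr a b xa xb), negPf (rr a w xa xw), negPf (rr b w xb xw)).
by case=> [] [[|[|[|i]]] lt_i] //; case=> [] [[|[|[|j]]] lt_j] //;
  rewrite [LHS]/= ?adjE // adj_sym adjE.
Qed.
End ShortestCycle.

(** * Upper bounds for cycles, ears and K_{2,3} *)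

(** A cycle is an ear attached at both ends to one of its vertices. *)
Lemma card_colourings_cycle (G : sgraph) p (c : seq G) :
    simple_cycle c ->
  #|colourings p [set:: c]| + (if odd (size c) then p else 0)
    <= p ^ size c + (if odd (size c) then 0 else p).
Proof.
case: c => // x vs /and3P[_ _ c_cycle].
have sizeE (a : 'I_p.+1) := size_walks (size vs) a a.
have size0 := sizeE ord0; rewrite eqxx muln1 in size0.
set W := size (walks _ _ _) in size0.
have := card_colourings_ear (set11 x) (set11 x) c_cycle (M := W) (p := p).
have -> : [set x] :|: [set:: vs] = [set:: x :: vs].
  by apply/setP=> y; rewrite !inE.
have sizeM (a b : 'I_p.+1) : (x = x -> a = b) ->
    size (walks (size vs) a b) <= W.
  move=> /(_ erefl) <-; have := sizeE a; rewrite eqxx muln1 -size0.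
  by move/addIn/eqP; rewrite eqn_pmul2l // => /eqP->.
move/(_ sizeM) => {sizeM}; have := card_colourings1 p x; move: size0 => /=.
by move: W #|_| #|_| (p ^ _) => w k1 k e; case: (odd _) => /=; nia.
Qed.

(** The largest value of q W over all colours of the ends is p^(k+1) + p or
p^(k+1) + 1 according to parity; the weaker of the two bounds serves for
both. *)
Lemma card_colourings_ear_le (G : sgraph) p (S : {set G}) x y vs :
    0 < p -> x \in S -> y \in S -> path adj x (rcons vs y) ->
  p.+1 * #|colourings p (S :|: [set:: vs])|
    <= (p ^ (size vs).+1 + p) * #|colourings p S|.
Proof.
move=> p_gt0 Sx Sy xy_path; set w := _ + p.
have := @card_colourings_ear G p S x y vs (w %/ p.+1) Sx Sy xy_path.
move=> ear; have {ear} :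
    #|colourings p (S :|: [set:: vs])| <= w %/ p.+1 * #|colourings p S|.
  apply: ear => a b _; rewrite leq_divRL // mulnC.
  have := size_walks (size vs) a b; rewrite /w.
  by case: (odd _); case: (a == b) => /=; lia.
rewrite -(leq_pmul2l (ltn0Sn p)) => /leq_trans; apply.
by rewrite mulnA leq_mul2r mulnC leq_divM orbT.
Qed.

(** The gain comes from the factor q = p + 1 on the left, which lets the product
p^(l+m+1) of the leading terms account for only a fraction p / (p + 1) of
p^(l+m); the bounds on l and m make the other terms smaller than the
remaining p^(l+m) / (p + 1). *)
Lemma few_ear_colourings p l m k :
    1 < p -> 3 < l -> 1 < m -> p.+1 * k <= (p ^ m.+1 + p) * (p ^ l + p) ->
  k + p < p ^ (l + m).
Proof.
move=> p_gt1 l_gt3 m_gt1.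
set a := p ^ l.-2; set b := p ^ m.-1.
have a_ge : p * p <= a by rewrite mulnn leq_pexp2l //; lia.
have b_ge : p <= b by rewrite -[X in X <= _]expn1 leq_pexp2l //; lia.
have -> : p ^ l = p * p * a by rewrite mulnn -expnD; congr (p ^ _); lia.
have -> : p ^ m.+1 = p * p * b by rewrite mulnn -expnD; congr (p ^ _); lia.
have -> : p ^ (l + m) = p * p * p * (a * b).
  by rewrite mulnn -expnSr -!expnD; congr (p ^ _); lia.
have ab : a + b + 2 <= a * b by nia.
have : p * p * p * (a + b + 2) <= p * p * p * (a * b).
  by rewrite leq_mul2l ab orbT.
have : 2 * (p * p) <= p * (p * p) by rewrite leq_mul2r p_gt1 orbT.
have : 2 * p <= p * p by rewrite leq_mul2r p_gt1 orbT.
move=> pp ppp abp k_le; rewrite -(ltn_pmul2l (ltn0Sn p)).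
nia.
Qed.

(** Once x and y are coloured, the other colours are what is left for each of the
three common neighbours: p if x and y agree, p - 1 otherwise. *)
Lemma card_colourings_two_three (G : sgraph) p (x y : G) vs :
  size vs = 3 -> all (adj x) vs -> all (adj y) vs ->
  #|colourings p [set:: [:: x, y & vs]]| <= p.+1 * (p ^ 3 + p * p.-1 ^ 3).
Proof.
move=> size_vs xs ys.
pose D (a b : 'I_p.+1) := [seq c <- enum 'I_p.+1 | (a != c) && (b != c)].
pose T (s : seq 'I_p.+1) :=
  [seq c :: t | c <- s, t <- [seq [:: d; e] | d <- s, e <- s]].
pose L (a : 'I_p.+1) := [seq b :: t | b <- enum 'I_p.+1, t <- T (D a b)].
have sizeD a b : size (D a b) = p - (b != a).
  rewrite size_filter -sum1_count big_enum_cond.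
  have := cardC (pred2 a b); rewrite card2 card_ord -[X in _ + X]sum1_card.
  rewrite (eq_bigl (fun c => (a != c) && (b != c))) => [|c]; last first.
    by rewrite !inE negb_or ![c == _]eq_sym.
  rewrite [b == a]eq_sym /= => /eqP; rewrite addSn eqSS => /eqP sumD.
  by rewrite -[X in X - _]sumD addKn.
have sizeL a : size (L a) = p ^ 3 + p * p.-1 ^ 3.
  rewrite size_allpairs_dep sumnE big_map big_enum (bigD1 a) //=.
  rewrite !size_allpairs sizeD eqxx subn0 !expnS expn0 muln1; congr (_ + _).
  rewrite (eq_bigr (fun=> p.-1 * (p.-1 * p.-1))) => [|b ba].
    by rewrite (sum_nat_const (predC1 a)) cardC1 card_ord muln1.
  by rewrite !size_allpairs sizeD ba subn1.
have -> : [set:: [:: x, y & vs]] = [set x] :|: [set:: y :: vs].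
  by apply/setP=> z; rewrite !inE.
rewrite mulnC; apply: leq_trans (leq_mul (leqnn _) (card_colourings1 p x)).
apply: (card_colourings_extend (L := fun g => L (g x))) => [g|f].
  by rewrite sizeL.
case/colouringsP=> fP _; rewrite ffunE set11.
apply/allpairsPdep; exists (f y), (map f vs); split=> //.
  by rewrite mem_enum.
have inD : {in vs, forall v, f v \in D (f x) (f y)}.
  move=> v v_vs; rewrite mem_filter mem_enum andbT.
  by rewrite !fP ?(allP xs) ?(allP ys) ?inE ?eqxx ?v_vs ?orbT.
case: vs size_vs inD {xs ys fP} => [|a [|b [|c []]]] // _ inD.
apply/allpairsP; exists (f a, [:: f b; f c]).
split; rewrite ?inD ?inE ?eqxx ?orbT //.
by apply/allpairsP; exists (f b, f c); rewrite !inD ?inE ?eqxx ?orbT.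
Qed.

(** The two colours of the class of size 2 come first in each list. *)
Definition K23_colours : seq (seq nat) :=
  [seq s <- iter 5 (fun L => [seq c :: s | c <- iota 0 3, s <- L]) [:: [::]]
     | allrel (fun c d => c != d) (take 2 s) (drop 2 s)].

(** There are 3 * 8 colourings in which the class of size 2 has one colour and
6 * 1 in which it has two. *)
Lemma hom_K23_ge : 30 <= hom (complete_bipartite 2 3) (complete 3).
Proof.
pose colour (s : seq nat) : {ffun complete_bipartite 2 3 -> 'I_3} :=
  [ffun u => inord (nth 0 s (K23_index u))].
have wf : {in K23_colours, forall s, (size s == 5) && all (gtn 3) s}.
  by apply/allP; vm_compute.
have -> : 30 = size (map colour K23_colours) by rewrite size_map; vm_compute.
rewrite -(card_uniqP _).
  apply/subset_leq_card/subsetP=> _ /mapP[s s_in ->]; rewrite inE.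
  have /andP[/eqP size_s /allP s_lt] := wf s s_in.
  move: s_in; rewrite mem_filter => /andP[/allrelP s_proper _].
  have split_s (i : 'I_2) (j : 'I_3) : nth 0 s i != nth 0 s (2 + j).
    apply: s_proper.
      by rewrite -(nth_take 0 (ltn_ord i)) mem_nth // size_take size_s.
    by rewrite -nth_drop mem_nth // size_drop size_s.
  have colour_neq (u v : complete_bipartite 2 3) :
      nth 0 s (K23_index u) != nth 0 s (K23_index v) ->
      colour s u != colour s v.
    apply: contra; rewrite !ffunE -val_eqE /= !inordK //;
      by apply: s_lt; rewrite mem_nth // size_s K23_index_lt.
  apply/forallP=> u; apply/forallP=> v; apply/implyP=> uv; apply: colour_neq.
  case: u v uv => i [] j //= _; last rewrite eq_sym; exact: split_s.
have uniq_K : uniq K23_colours by vm_compute.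
rewrite map_inj_in_uniq // => s t.
case/wf/andP=> /eqP size_s /allP s_lt /wf/andP[/eqP size_t /allP t_lt].
move/ffunP=> eq_st.
apply: (eq_from_nth (x0 := 0)) => [|i]; rewrite size_s // => lt_i.
have [u <-] : exists u, K23_index u = i.
  have [lt_i2|le2i] := ltnP i 2; first by exists (inl (Ordinal lt_i2)).
  have lt_i3 : i - 2 < 3 by lia.
  by exists (inr (Ordinal lt_i3)); rewrite /K23_index /=; lia.
have := eq_st u; rewrite !ffunE => /(congr1 val) /=.
have lt_u := K23_index_lt u.
rewrite !inordK //; first by apply: t_lt; rewrite mem_nth ?size_t.
by apply: s_lt; rewrite mem_nth ?size_s.
Qed.

(** * The extremal theorem *)

(** The difference p^5 - p - q (p^3 + p (p-1)^3) = p^2 (p-2)(p+1), with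
p = r + 2 to avoid truncated subtractions. *)
Lemma two_three_count r :
  r.+3 * (r.+2 ^ 3 + r.+2 * r.+1 ^ 3) + r.+2 + r.+2 ^ 2 * r * r.+3 = r.+2 ^ 5.
Proof. by rewrite !expnS !expn0; nia. Qed.

(** The arc between x and y through s2 is replaced by the vertex w. *)
Lemma detour_cycle (G : sgraph) (x y w : G) s1 s2 :
    uniq (x :: s1 ++ y :: s2) -> cycle adj (x :: s1 ++ y :: s2) ->
    w \notin x :: s1 ++ y :: s2 -> adj x w -> adj w y ->
  simple_cycle (x :: rcons (rcons s1 y) w).
Proof.
rewrite /cycle -cat_rcons rcons_cat cat_path -cat_cons cat_uniq mem_cat negb_or.
case/and3P=> Us1 _ _ /andP[xy_path _] /andP[w_s1 _] xw wy.
apply/and3P; split; first by rewrite /= !size_rcons.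
  by rewrite -rcons_cons rcons_uniq w_s1.
rewrite /cycle 2!rcons_path xy_path !last_rcons.
by rewrite [adj y w]adj_sym [adj w x]adj_sym wy.
Qed.

(** Replacing either of the two arcs between x and y by w gives a cycle, which
is not shorter; so each arc has at most one interior vertex, and parity leaves
only the 4-cycle with x and y opposite. *)
Lemma shortest_cycle_common_neighbour (G : sgraph) (c : seq G) x y w :
    shortest_cycle c -> 3 < size c -> ~~ odd (size c) ->
    x \in c -> y \in c -> w \notin c -> x != y -> adj x w -> adj w y ->
  exists a b, [/\ uniq [:: x; y; a; b; w], all (adj x) [:: a; b; w],
    all (adj y) [:: a; b; w] & size c = 4].
Proof.
move=> c_short c_gt3 c_even c_x c_y c'w xy xw wy.
have [k s def_c] := rot_to c_x; have := shortest_cycle_rot k c_short.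
move: c_gt3 c_even c_y c'w; rewrite -(size_rot k) -!(mem_rot k c) {}def_c.
move=> c_gt3 c_even; rewrite inE eq_sym (negPf xy) /= => s_y.
case/splitPr: s_y c_gt3 c_even => s1 s2 c_gt3 c_even c'w.
case=> /and3P[_ Uc c_cycle] c_min.
have := c_min _ (detour_cycle Uc c_cycle c'w xw wy).
have rotE : rot (size (x :: s1)) (x :: s1 ++ y :: s2) = y :: s2 ++ x :: s1.
  by rewrite -cat_cons rot_size_cat.
have := @detour_cycle G y x w s2 s1; rewrite -rotE rot_uniq rot_cycle mem_rot.
rewrite ![adj _ w]adj_sym ![adj w x]adj_sym => /(_ Uc c_cycle c'w wy xw)/c_min.
move: c_even; rewrite /= !size_rcons !size_cat /= addnS /= negbK oddD.
move=> parity le1 le2.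
have [size1 size2] : size s1 = 1 /\ size s2 = 1.
  move: parity c_gt3 le1 le2; rewrite /= size_cat /=.
  by case: (size s1) (size s2) => [|[|m1]] [|[|m2]] //=; lia.
case: s1 size1 Uc c_cycle c'w {c_min le1 le2 parity rotE c_gt3} => [|a []] // _.
case: s2 size2 => [|b []] // _.
rewrite /= !inE !negb_or andbT => /and3P[/and3P[xa _ xb] /andP[ay ab] yb].
case/and4P=> adj_xa adj_ay adj_yb /andP[adj_bx _] /and4P[wx wa wy' wb].
exists a, b; split=> //=.
- rewrite !inE !negb_or xy xa xb yb ab ![_ == w]eq_sym wx wa wy' wb.
  by rewrite eq_sym ay.
- by rewrite adj_xa xw adj_sym adj_bx.
- by rewrite adj_yb ![adj y _]adj_sym adj_ay wy.
Qed.

(** The defect p on S becomes p^(n-|S|) p on the whole graph, which exceeds p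
unless S is everything. *)
Lemma hom_extend_colourings (G : sgraph) p (S : {set G}) s :
    k_edge_connected 2 G -> 1 < p -> s \in S ->
    #|colourings p S| + p <= p ^ #|S| ->
  hom G (complete p.+1) + p <= p ^ #|G| /\
  (hom G (complete p.+1) + p = p ^ #|G| ->
     #|S| = #|G| /\ #|colourings p S| + p = p ^ #|S|).
Proof.
move=> G2 p_gt1 Ss few.
have := card_colourings_spanning p (k_edge_connected_connect G2) Ss.
have leS : #|S| <= #|G| by apply: max_card.
have -> : p ^ #|G| = p ^ (#|G| - #|S|) * p ^ #|S| by rewrite -expnD subnK.
move: (hom _ _) => h; have [d0|d_gt0] := posnP (#|G| - #|S|).
  by rewrite d0 expn0 !mul1n => h_le; split; [|move=> eqh; split]; lia.
have : p ^ 1 <= p ^ (#|G| - #|S|) by rewrite leq_pexp2l //; apply: ltnW.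
rewrite expn1; move: (p ^ (_ - _)) (p ^ _) few => e f few pe h_le.
have : e * (#|colourings p S| + p) <= e * f by rewrite leq_mul2l few orbT.
have : 2 * p <= e * p by rewrite leq_mul2r (leq_trans p_gt1 pe) orbT.
by rewrite mulnDr; lia.
Qed.

(** One bound serves both parities: p^n - p is the number of colourings of an
odd n-cycle, and lies 2p below that of an even one. *)
Lemma cycle_or_few_colourings (G : sgraph) p :
    1 < p -> k_edge_connected 2 G ->
  giso G (cycle_graph #|G|) \/
  (hom G (complete p.+1) + p <= p ^ #|G| /\
   (hom G (complete p.+1) + p = p ^ #|G| ->
      [/\ p = 2, #|G| = 5 & giso G (complete_bipartite 2 3)])).
Proof.
move=> p_gt1 G2; have [c c_short] := exists_shortest_cycle G2.
have [c_simple c_min] := c_short; have /and3P[c_gt2 Uc c_cycle] := c_simple.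
have card_c : #|[set:: c]| = size c by rewrite cardsE; apply/card_uniqP.
have [size_c|c_small] := eqVneq (size c) #|G|.
  by left; apply: giso_cycle_graph c_short size_c.
right; have c_le : size c <= #|G| by rewrite -card_c; apply: max_card.
have [s s_c] : exists s, s \in [set:: c].
  by case: (c) c_gt2 => // s c' _; exists s; rewrite !inE eqxx.
have cyc := card_colourings_cycle p c_simple.
(* For c odd, the closed walks along c already number only p^l - p, where l is
   the length of c. *)
case: (boolP (odd (size c))) => c_odd.
  rewrite c_odd addn0 in cyc.
  have [|le_h eq_h] := hom_extend_colourings G2 p_gt1 s_c.
    by rewrite card_c.
  by split=> // /eq_h[]; rewrite card_c => /eqP; rewrite (negPf c_small).
rewrite (negPf c_odd) addn0 in cyc.
have c_gt3 : 3 < size c by move: c_odd; case: (size c) c_gt2 => [|[|[|[|m]]]].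
have [t c't] : exists t, t \notin [set:: c].
  have /subsetPn[t _ c't] : ~~ ([set: G] \subset [set:: c]); last by exists t.
  apply: contra c_small => /subset_leq_card.
  by rewrite cardsT card_c eqn_leq c_le.
have [x [y [vs [[Sx Sy] ear Uvs S'vs [vs_gt0 vs_neq1]]]]] :=
  exists_ear G2 s_c c't.
have card_T : #|[set:: c] :|: [set:: vs]| = size c + size vs.
  rewrite cardsU card_c cardsE (card_uniqP Uvs) (_ : _ :&: _ = set0);
    first by rewrite cards0 subn0.
  apply/setP=> z; rewrite !inE; apply/negP=> /andP[cz /(allP S'vs)].
  by rewrite /= inE cz.
have s_T : s \in [set:: c] :|: [set:: vs] by rewrite inE s_c.
(* With a single outer vertex, the bound for ears is only p (p^l + p), which is
   too large. *)
have [vs_gt1|vs_le1] := ltnP 1 (size vs).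
  have few : #|colourings p ([set:: c] :|: [set:: vs])| + p
               < p ^ (size c + size vs).
    apply: few_ear_colourings => //.
    apply: leq_trans (card_colourings_ear_le _ Sx Sy ear) _; first exact: ltnW.
    by rewrite leq_mul2l cyc orbT.
  have [|le_h eq_h] := hom_extend_colourings G2 p_gt1 s_T.
    by rewrite card_T; apply: ltnW.
  split=> // /eq_h[_]; rewrite card_T => eq_few.
  by move: few; rewrite eq_few ltnn.
case: vs vs_gt0 vs_le1 vs_neq1 ear Uvs S'vs card_T s_T => [|w []] // _ _.
move=> /(_ erefl) xy.
rewrite /= !andbT => /andP[xw wy] _; rewrite inE => c'w _ _.
move: Sx Sy c'w; rewrite !inE => c_x c_y c'w.
have [a [b [Us xs ys _]]] :=
  shortest_cycle_common_neighbour c_short c_gt3 c_odd c_x c_y c'w xy xw wy.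
have card_S : #|[set:: [:: x; y; a; b; w]]| = 5.
  by rewrite cardsE; apply/card_uniqP.
have few := card_colourings_two_three p (erefl : size [:: a; b; w] = 3) xs ys.
case: p p_gt1 few {cyc} => [|[|r]] // p_gt1 few.
have count := two_three_count r.
have [||le_h eq_h] :=
  @hom_extend_colourings G r.+2 [set:: [:: x; y; a; b; w]] x G2 isT.
- by rewrite !inE eqxx.
- by rewrite card_S -count; apply: leq_trans (leq_addr _ _); rewrite leq_add2r.
split=> // /eq_h[card_G eq_few]; rewrite card_S in card_G eq_few.
have r0 : r = 0.
  have : r.+2 ^ 2 * r * r.+3 == 0.
    rewrite -leqn0 -(leq_add2l (r.+3 * (r.+2 ^ 3 + r.+2 * r.+1 ^ 3) + r.+2)).
    by rewrite addn0 count -eq_few leq_add2r.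
  by rewrite !muln_eq0 /= orbF => /eqP.
split; rewrite ?r0 //; apply: giso_complete_bipartite xs ys => // u v z.
exact: shortest_cycle_triangle_free c_short c_gt3.
Qed.

Lemma two_edge_connected_extremal n q (G : sgraph) :
    3 <= n -> 3 <= q -> #|G| = n -> k_edge_connected 2 G ->
  [/\ hom G (complete q) <= hom (cycle_graph n) (complete q),
      ~ (q = 3 /\ n = 5) ->
        (hom G (complete q) = hom (cycle_graph n) (complete q) <->
         giso G (cycle_graph n))
    & q = 3 /\ n = 5 ->
        (hom G (complete q) = hom (cycle_graph n) (complete q) <->
         giso G (cycle_graph 5) \/ giso G (complete_bipartite 2 3))].
Proof.
case: q => // p n_gt2 p_gt1 card_G G2; have cyc := hom_cycle_graph p n_gt2.
have := cycle_or_few_colourings p_gt1 G2; rewrite card_G.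
set hG := hom G _; set hC := hom (cycle_graph n) _ in cyc *.
have iso_eq : giso G (cycle_graph n) -> hG = hC by apply: giso_hom.
have cyc_ge : p ^ n <= hC + p by move: cyc; case: (odd n); lia.
case=> [G_cycle | [few few_eq]].
  have eq_h := iso_eq G_cycle; split=> [|_|[_ n5]]; first by rewrite eq_h.
    by split.
  by split=> // _; left; rewrite -n5.
have eq_K23 : hG = hC -> [/\ p = 2, n = 5 & giso G (complete_bipartite 2 3)].
  by move=> eq_h; apply: few_eq; apply/eqP; rewrite eqn_leq few eq_h.
have le_h : hG <= hC by lia.
split=> // [not35|[[p2] n5]]; split=> //.
- by case/eq_K23=> p2 n5 _; case: not35; rewrite p2 n5.
- by case/eq_K23; right.
case=> [|G_K23]; first by rewrite -n5; apply: iso_eq.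
apply/eqP; rewrite eqn_leq le_h; have := hom_K23_ge.
rewrite -(giso_hom _ G_K23) -p2 -/hG.
by move: cyc; rewrite n5 p2 !expnS expn0 /=; lia.
Qed.

Theorem theorem1p5 (n q : nat) (hn : 3 <= n) (hq : 3 <= q) :
  (forall G : sgraph, #|G| = n -> k_connected 2 G ->
     [/\ hom G (complete q) <= hom (cycle_graph n) (complete q),
         ~ (q = 3 /\ n = 5) ->
           (hom G (complete q) = hom (cycle_graph n) (complete q) <->
            giso G (cycle_graph n))
       & q = 3 /\ n = 5 ->
           (hom G (complete q) = hom (cycle_graph n) (complete q) <->
            giso G (cycle_graph 5) \/ giso G (complete_bipartite 2 3))])
  /\
  (forall G : sgraph, #|G| = n -> k_edge_connected 2 G ->
     [/\ hom G (complete q) <= hom (cycle_graph n) (complete q),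
         ~ (q = 3 /\ n = 5) ->
           (hom G (complete q) = hom (cycle_graph n) (complete q) <->
            giso G (cycle_graph n))
       & q = 3 /\ n = 5 ->
           (hom G (complete q) = hom (cycle_graph n) (complete q) <->
            giso G (cycle_graph 5) \/ giso G (complete_bipartite 2 3))]).
Proof.
split=> G card_G G2; apply: two_edge_connected_extremal => //.
exact: k_connected_edge_connected.
Qed.
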